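(* Fix $\beta>0$. For every $\vartheta$ with $$0<\vartheta\le\frac{80}{119},$$ there is a slack-last quadratic program with $m=3$, $$\min_{x,y,z}\ \tfrac12x^\top Q_1x+c_1^\top x+\tfrac12y^\top Q_2y+c_2^\top y+\iota_{\mathbb{R}_+^3}(z)\quad\text{s.t.}\quad Ax+By+z=b,$$ with $Q_1,Q_2\succ0$ and $[A\ B]$ of full row rank, together with a finite feasible initialization (that is, $Ax^0+By^0+z^0=b$ and $z^0\in\mathbb{R}_+^3$), for which the direct $x\to y\to z\to\lambda$ ADMM with penalty $\beta$ and relative multiplier step $\vartheta=\tau/\beta$ generates a bounded nonconvergent sequence. Consequently, there is no $\bar\vartheta>0$ such that, for every problem in the class $\mathcal C$ defined in the context, the method converges for every relative step $0<\vartheta<\bar\vartheta$.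
   Context: $\iota_C$ is the indicator function of $C$. For a problem $\min F(x)+G(y)+\iota_{\mathbb{R}_+^m}(z)$ s.t. $Ax+By+z=b$, the augmented Lagrangian is $$\mathcal L_\beta(x,y,z,\lambda)=F(x)+G(y)+\iota_{\mathbb{R}_+^m}(z)-\lambda^\top r+\tfrac{\beta}{2}\|r\|^2,\qquad r=Ax+By+z-b .$$ The direct ADMM with penalty $\beta>0$ and multiplier step $\tau>0$ (relative step $\vartheta=\tau/\beta$) is $$x^{k+1}\in\operatorname{argmin}_x\mathcal L_\beta(x,y^k,z^k,\lambda^k),\quad y^{k+1}\in\operatorname{argmin}_y\mathcal L_\beta(x^{k+1},y,z^k,\lambda^k),\quad z^{k+1}\in\operatorname{argmin}_z\mathcal L_\beta(x^{k+1},y^{k+1},z,\lambda^k),$$ $$\lambda^{k+1}=\lambda^k-\tau(Ax^{k+1}+By^{k+1}+z^{k+1}-b).$$ The class $\mathcal C$ consists of all problems of the form $\min_{x,y,z}F(x)+G(y)+\iota_{\mathbb{R}_+^m}(z)$ s.t. $Ax+By+z=b$ in which $F:\mathbb{R}^{n_x}\to\mathbb{R}$ and $G:\mathbb{R}^{n_y}\to\mathbb{R}$ are continuously differentiable and strongly convex with Lipschitz gradients and $[A\ B]$ has full row rank; strongly convex quadratic programs as in the claim belong to $\mathcal C$. ''The method converges'' means it converges from every finite initialization with $z^0\in\mathbb{R}_+^m$. *)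

(* Defs.v *)
From mathcomp Require Import all_boot all_order all_algebra.
From mathcomp Require Import all_classical all_reals all_analysis.

Set Implicit Arguments.
Unset Strict Implicit.
Unset Printing Implicit Defensive.

Import Order.TTheory GRing.Theory Num.Theory.
Import numFieldNormedType.Exports.

Local Open Scope classical_set_scope.
Local Open Scope ring_scope.

Section Vectors.
Context {R : realType}.

Definition dotp (n : nat) (u v : 'cV[R]_n) : R := (u^T *m v) 0 0.

(* The library norm `|u| on 'cV[R]_n is the sup norm, hence this definition. *)
Definition enorm (n : nat) (u : 'cV[R]_n) : R := Num.sqrt (dotp u u).

Definition orthant (m : nat) : set 'cV[R]_m := [set z | forall i, 0 <= z i 0].

Definition posdef (n : nat) (Q : 'M[R]_n) : Prop :=
  Q^T = Q /\ forall x : 'cV[R]_n, x != 0 -> 0 < dotp x (Q *m x).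

Definition quad (n : nat) (Q : 'M[R]_n) (c x : 'cV[R]_n) : R :=
  2^-1 * dotp x (Q *m x) + dotp c x.

Definition gradient (n : nat) (F : 'cV[R]_n -> R) (x : 'cV[R]_n) : 'cV[R]_n :=
  \col_i 'D_(delta_mx i 0) F x.

Definition continuously_differentiable (n : nat) (F : 'cV[R]_n -> R) : Prop :=
  (forall x, differentiable F x) /\ continuous (gradient F).

Definition strongly_convex (n : nat) (F : 'cV[R]_n -> R) : Prop :=
  exists2 mu : R, 0 < mu & forall (x y : 'cV[R]_n) (t : R), 0 <= t <= 1 ->
    F (t *: x + (1 - t) *: y) <=
      t * F x + (1 - t) * F y - mu / 2 * t * (1 - t) * enorm (x - y) ^+ 2.

Definition lipschitz_gradient (n : nat) (F : 'cV[R]_n -> R) : Prop :=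
  exists2 L : R, 0 <= L & forall x y : 'cV[R]_n,
    enorm (gradient F x - gradient F y) <= L * enorm (x - y).

End Vectors.

Section Optimization.
Context {R : realType}.
Local Open Scope ereal_scope.

Definition indicator (T : Type) (C : set T) (z : T) : \bar R :=
  if z \in C then 0 else +oo.

(* If f is identically +oo every point is a minimizer; this does not happen
   below, where f is finite somewhere as soon as z^0 is in the orthant. *)
Definition argmin (T : Type) (f : T -> \bar R) : set T :=
  [set x | forall x', f x <= f x'].

End Optimization.

(* min F(x) + G(y) + iota_{R_+^m}(z)  s.t.  A x + B y + z = b *)
Record slack_problem (R : realType) (m nx ny : nat) := SlackProblem {
  objF : 'cV[R]_nx -> R;
  objG : 'cV[R]_ny -> R;
  mxA : 'M[R]_(m, nx);
  mxB : 'M[R]_(m, ny);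
  rhs : 'cV[R]_m }.

Section Admm.
Context {R : realType} {m nx ny : nat}.
Implicit Type P : slack_problem R m nx ny.

Definition slack_qp (Q1 : 'M[R]_nx) (c1 : 'cV[R]_nx)
    (Q2 : 'M[R]_ny) (c2 : 'cV[R]_ny)
    (A : 'M[R]_(m, nx)) (B : 'M[R]_(m, ny)) (b : 'cV[R]_m) :=
  SlackProblem (quad Q1 c1) (quad Q2 c2) A B b.

Definition residual P (x : 'cV[R]_nx) (y : 'cV[R]_ny) (z : 'cV[R]_m) : 'cV[R]_m :=
  mxA P *m x + mxB P *m y + z - rhs P.

Definition aug_lagrangian P (beta : R)
    (x : 'cV[R]_nx) (y : 'cV[R]_ny) (z lam : 'cV[R]_m) : \bar R :=
  let r := residual P x y z in
  ((objF P x)%:E + (objG P y)%:E + indicator (@orthant R m) z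
    - (dotp lam r)%:E + (beta / 2 * enorm r ^+ 2)%:E)%E.

Definition admm P (beta tau : R) (x : nat -> 'cV[R]_nx) (y : nat -> 'cV[R]_ny)
    (z lam : nat -> 'cV[R]_m) : Prop :=
  forall k : nat,
  [/\ argmin (fun x' => aug_lagrangian P beta x' (y k) (z k) (lam k)) (x k.+1),
      argmin (fun y' => aug_lagrangian P beta (x k.+1) y' (z k) (lam k)) (y k.+1),
      argmin (fun z' => aug_lagrangian P beta (x k.+1) (y k.+1) z' (lam k)) (z k.+1)
    & lam k.+1 = lam k - tau *: residual P (x k.+1) (y k.+1) (z k.+1)].

Definition iterates (x : nat -> 'cV[R]_nx) (y : nat -> 'cV[R]_ny)
    (z lam : nat -> 'cV[R]_m) (k : nat) :
    'cV[R]_nx * 'cV[R]_ny * 'cV[R]_m * 'cV[R]_m :=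
  (x k, y k, z k, lam k).

(* The library's cvgn needs a pointed topological instance that products lack. *)
Definition iterates_cvg (x : nat -> 'cV[R]_nx) (y : nat -> 'cV[R]_ny)
    (z lam : nat -> 'cV[R]_m) : Prop :=
  exists w : 'cV[R]_nx * 'cV[R]_ny * 'cV[R]_m * 'cV[R]_m,
    iterates x y z lam @ \oo --> w.

Definition admm_converges P (beta tau : R) : Prop :=
  forall x y z lam, orthant (z 0%N) -> admm P beta tau x y z lam ->
    iterates_cvg x y z lam.

Definition classC P : Prop :=
  [/\ [/\ (0 < m)%N, (0 < nx)%N & (0 < ny)%N],
      [/\ continuously_differentiable (objF P), strongly_convex (objF P)
        & lipschitz_gradient (objF P)],
      [/\ continuously_differentiable (objG P), strongly_convex (objG P)
        & lipschitz_gradient (objG P)]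
    & row_free (row_mx (mxA P) (mxB P))].

End Admm.

(* Main.v *)
Require Import Defs.
From mathcomp Require Import all_boot all_order all_algebra.
From mathcomp Require Import all_classical all_reals all_analysis.
From mathcomp Require Import ring lra.

Import Order.TTheory GRing.Theory Num.Theory.
Import numFieldNormedType.Exports.

Local Open Scope classical_set_scope.
Local Open Scope ring_scope.

(** Close to a KKT point whose first slack is positive and whose other two slacks
vanish with positive dual margins, the projection onto the orthant is the
identity on the first coordinate and zero on the others, so the method is a
linear map there. The problem is designed so that this linear map has a
conjugate pair of eigenvalues exactly on the unit circle; an orbit in the
corresponding plane rotates for ever. Large margins (the constant [offset])
keep the whole orbit in the region where the map is linear.

The design works as follows. Divide the multiplier by [beta] and put
zeta = (1 + iT) / (1 - iT) with T = tan (phi / 2), where phi is the rotation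
angle. Look for an orbit, relative to the KKT point, of the form
A x^k = Re (zeta^k u) and B y^k = Re (zeta^k v) with complex vectors u and v.
The z-step and the multiplier step then force
z_1 = - (u + v)_1 and lambda_j / beta = theta zeta / (1 - zeta) (u + v)_j
for j = 2, 3. The vectors that A^T and B^T multiply in the optimality conditions of
the x-step and the y-step are therefore zeta p and zeta p', where
- p_1 = (conj zeta - 1) u_1 and p_j = g (u + v)_j + (1 - conj zeta) v_j,
- p'_1 = (conj zeta - 1) (u + v)_1 and p'_j = g (u + v)_j,

with g = theta / (1 - zeta) - 1 = (theta / 2 - 1) + i theta / (2T). Let the
columns of A be Re u and Im u, so that x^k is a rotating point of the plane,
and let B be the real vector v. The x-step is satisfied as soon as Q1 is beta
times the 2 x 2 matrix of the products of (Re u, Im u) with (Re p, Im p), and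
the y-step as soon as Q2 = beta v . p'. Hence the orbit exists as soon as
that matrix is symmetric positive definite and v . p' is a positive real number.

With T = theta / 128, which makes theta / (2T) = 64, the choice
v = (2, 1, 0) and u = (-1 + 16 i, -1 + h, i r) works: the small complex number
h makes v . p' real, and the real number r makes the matrix symmetric. Divided by
sin phi, the matrix is close to ((8, -4), (-4, 12)) and v . p' is close to 8 for
all 0 < theta <= 1, because T is at most 1 / 128. A
nontrivial rotation preserves the norm and fixes only the origin, so the orbit is
bounded and has no limit.

A quadratic function with a positive definite Hessian Q is strongly convex with
Lipschitz gradient, because Q is bounded below by a positive multiple of the
identity ([posdef_coercive]). The problems above hence belong to the class, and
they exist for arbitrarily small theta, which excludes a uniform threshold. *)

(** * The Euclidean product *)

Section EuclideanStructure.
Context {R : realType}.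

Lemma dotpE n (u v : 'cV[R]_n) : dotp u v = \sum_i u i 0 * v i 0.
Proof. by rewrite /dotp mxE; apply: eq_bigr => i _; rewrite mxE. Qed.

Lemma dotpC {n} (u v : 'cV[R]_n) : dotp u v = dotp v u.
Proof. by rewrite !dotpE; apply: eq_bigr => i _; rewrite mulrC. Qed.

Lemma dotpDr n (u v w : 'cV[R]_n) : dotp u (v + w) = dotp u v + dotp u w.
Proof. by rewrite /dotp mulmxDr mxE. Qed.

Lemma dotpDl n (u v w : 'cV[R]_n) : dotp (u + v) w = dotp u w + dotp v w.
Proof. by rewrite dotpC dotpDr (dotpC w u) (dotpC w v). Qed.

Lemma dotpZr n (a : R) (u v : 'cV[R]_n) : dotp u (a *: v) = a * dotp u v.
Proof. by rewrite /dotp -scalemxAr mxE. Qed.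

Lemma dotpZl n (a : R) (u v : 'cV[R]_n) : dotp (a *: u) v = a * dotp u v.
Proof. by rewrite dotpC dotpZr dotpC. Qed.

Lemma dotpNr n (u v : 'cV[R]_n) : dotp u (- v) = - dotp u v.
Proof. by rewrite -scaleN1r dotpZr mulN1r. Qed.

Lemma dotpNl n (u v : 'cV[R]_n) : dotp (- u) v = - dotp u v.
Proof. by rewrite dotpC dotpNr dotpC. Qed.

Definition dotp_bilin := (dotpDl, dotpDr, dotpZl, dotpZr, dotpNl, dotpNr).

Lemma dotp_mulmx m n (A : 'M[R]_(m, n)) (x : 'cV[R]_n) (v : 'cV[R]_m) :
  dotp (A *m x) v = dotp x (A^T *m v).
Proof. by rewrite /dotp trmx_mul mulmxA. Qed.

Lemma dotp_symm {n} {Q : 'M[R]_n} (x y : 'cV[R]_n) :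
  Q^T = Q -> dotp x (Q *m y) = dotp y (Q *m x).
Proof. by move=> Qs; rewrite dotpC dotp_mulmx Qs. Qed.

Lemma dotp_ge0 {n} (u : 'cV[R]_n) : 0 <= dotp u u.
Proof. by rewrite dotpE sumr_ge0 // => i _; rewrite -expr2 sqr_ge0. Qed.

Lemma dotp_eq0 n (u : 'cV[R]_n) : dotp u u = 0 -> u = 0.
Proof.
rewrite dotpE => /psumr_eq0P u0; apply/colP => i; rewrite mxE.
have /eqP : u i 0 * u i 0 = 0.
  by apply: u0 => // j _; rewrite -expr2 sqr_ge0.
by rewrite mulf_eq0 orbb => /eqP.
Qed.

Lemma enorm_sqr n (u : 'cV[R]_n) : enorm u ^+ 2 = dotp u u.
Proof. by rewrite /enorm sqr_sqrtr // dotp_ge0. Qed.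

Lemma posdef_ge0 {n} {Q : 'M[R]_n} (x : 'cV[R]_n) :
  posdef Q -> 0 <= dotp x (Q *m x).
Proof.
case=> _ Qp; have [->|x0] := eqVneq x 0; last exact/ltW/Qp.
by rewrite mulmx0 /dotp mulmx0 mxE.
Qed.

End EuclideanStructure.

(** * First-order conditions for the three block minimizations *)

Section BlockMinimizers.
Context {R : realType}.

(** With d = x' - x and r = M x + e, the stationarity condition cancels the terms
that are linear in d, and the difference of the two sides is
d . Q d / 2 + beta |M d|^2 / 2. *)
Lemma quad_penalty_min {n m} {Q : 'M[R]_n} {c : 'cV[R]_n} {M : 'M[R]_(m, n)}
    {e lam : 'cV[R]_m} {beta : R} {x : 'cV[R]_n} (x' : 'cV[R]_n) :
  posdef Q -> 0 <= beta ->
  Q *m x + c = M^T *m (lam - beta *: (M *m x + e)) ->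
  quad Q c x - dotp lam (M *m x + e) + beta / 2 * enorm (M *m x + e) ^+ 2 <=
  quad Q c x' - dotp lam (M *m x' + e) + beta / 2 * enorm (M *m x' + e) ^+ 2.
Proof.
move=> Qp beta0.
have [d ->] : exists d, x' = x + d by exists (x' - x); rewrite addrC subrK.
have -> : M *m (x + d) + e = (M *m x + e) + M *m d by rewrite mulmxDr addrAC.
move: (M *m x + e) => r /(congr1 (dotp d)).
rewrite -dotp_mulmx !dotp_bilin => statd.
have dQd := posdef_ge0 d Qp.
have Md2 := dotp_ge0 (M *m d).
rewrite !enorm_sqr /quad mulmxDr !dotp_bilin.
rewrite (dotp_symm x d Qp.1) (dotpC c d) (dotpC lam (M *m d)) (dotpC r (M *m d)).
nra.
Qed.

(** Write g for the gradient beta (e + z) - lam at z. The hypotheses g >= 0 and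
z_i g_i = 0 give (z' - z) . g = z' . g >= 0, which is optimality for a convex
function. *)
Lemma orthant_penalty_min {m} {e lam : 'cV[R]_m} {beta : R} {z : 'cV[R]_m}
    (z' : 'cV[R]_m) : 0 <= beta -> orthant z' ->
  (forall i, 0 <= beta * (e + z) i 0 - lam i 0) ->
  (forall i, z i 0 * (beta * (e + z) i 0 - lam i 0) = 0) ->
  - dotp lam (e + z) + beta / 2 * enorm (e + z) ^+ 2 <=
  - dotp lam (e + z') + beta / 2 * enorm (e + z') ^+ 2.
Proof.
move=> beta0 z'0 g0 zg.
have dg : 0 <= dotp (z' - z) (beta *: (e + z) - lam).
  rewrite dotpE sumr_ge0 // => i _.
  have -> : (beta *: (e + z) - lam) i 0 = beta * (e + z) i 0 - lam i 0.
    by rewrite !mxE.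
  rewrite 2!mxE mulrBl zg subr0; exact: mulr_ge0.
have [d zd] : exists d, z' = z + d by exists (z' - z); rewrite addrC subrK.
move: dg; rewrite zd [z + d - z]addrAC subrr add0r addrA.
have d2 := dotp_ge0 d.
move: (e + z) => r; rewrite !enorm_sqr !dotp_bilin (dotpC d r) (dotpC d lam).
nra.
Qed.

End BlockMinimizers.

Section OptimalityConditions.
Context {R : realType} {m nx ny : nat}.
Implicit Types (P : slack_problem R m nx ny) (x : 'cV[R]_nx) (y : 'cV[R]_ny).
Implicit Types z lam : 'cV[R]_m.

(** The value of the augmented Lagrangian where the indicator vanishes. *)
Definition finite_lagrangian P (beta : R) x y z lam : R :=
  objF P x + objG P y - dotp lam (residual P x y z)
  + beta / 2 * enorm (residual P x y z) ^+ 2.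

Lemma aug_lagrangian_fin P beta x y z lam : orthant z ->
  aug_lagrangian P beta x y z lam = (finite_lagrangian P beta x y z lam)%:E.
Proof.
by move=> z0; rewrite /aug_lagrangian /indicator mem_set //= adde0.
Qed.

Lemma aug_lagrangian_pinfty P beta x y z lam : ~ orthant z ->
  aug_lagrangian P beta x y z lam = +oo%E.
Proof. by move=> z0; rewrite /aug_lagrangian /indicator memNset. Qed.

(** Each block subproblem is convex, so the orbit can be checked step by step
through linear equations and sign conditions instead of minimizations. *)
Lemma admm_step_of_kkt {Q1 : 'M[R]_nx} {c1 : 'cV[R]_nx} {Q2 : 'M[R]_ny}
    {c2 : 'cV[R]_ny} {A : 'M[R]_(m, nx)} {B : 'M[R]_(m, ny)} {b : 'cV[R]_m}
    {beta : R} {x' : 'cV[R]_nx} {y y' : 'cV[R]_ny} {z z' lam : 'cV[R]_m} :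
  let P := slack_qp Q1 c1 Q2 c2 A B b in
  let r' := residual P x' y' z' in
  posdef Q1 -> posdef Q2 -> 0 <= beta -> orthant z -> orthant z' ->
  Q1 *m x' + c1 = A^T *m (lam - beta *: residual P x' y z) ->
  Q2 *m y' + c2 = B^T *m (lam - beta *: residual P x' y' z) ->
  (forall i, 0 <= beta * r' i 0 - lam i 0) ->
  (forall i, z' i 0 * (beta * r' i 0 - lam i 0) = 0) ->
  [/\ argmin (fun x => aug_lagrangian P beta x y z lam) x',
      argmin (fun y => aug_lagrangian P beta x' y z lam) y'
    & argmin (fun z => aug_lagrangian P beta x' y' z lam) z'].
Proof.
move=> P r' Q1p Q2p beta0 z0 z'0 statx staty g0 zg.
split=> t /=.
- rewrite !aug_lagrangian_fin // lee_fin /finite_lagrangian /=.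
  have resE s : residual P s y z = A *m s + (B *m y + z - b).
    by rewrite /residual /= !addrA.
  rewrite resE in statx; have := quad_penalty_min t Q1p beta0 statx.
  rewrite !resE; lra.
- rewrite !aug_lagrangian_fin // lee_fin /finite_lagrangian /=.
  have resE s : residual P x' s z = B *m s + (A *m x' + z - b).
    by rewrite /residual /= (addrC (A *m x')) !addrA.
  rewrite resE in staty; have := quad_penalty_min t Q2p beta0 staty.
  rewrite !resE; lra.
- have [t0|t0] := pselect (orthant t); last first.
    by rewrite [leRHS]aug_lagrangian_pinfty // leey.
  rewrite !aug_lagrangian_fin // lee_fin /finite_lagrangian /=.
  have resE s : residual P x' y' s = (A *m x' + B *m y' - b) + s.
    by rewrite /residual /= addrAC.
  rewrite /r' resE in g0 zg; have := orthant_penalty_min t beta0 t0 g0 zg.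
  rewrite !resE; lra.
Qed.

End OptimalityConditions.

(** * Strongly convex quadratic programs belong to the class *)

Section PositiveDefiniteQuadratics.
Context {R : realType} {n : nat}.
Implicit Types (Q M : 'M[R]_n) (c x y v : 'cV[R]_n).

Lemma quadratic_form_bound M :
  exists2 L : R, 0 < L & forall x, dotp x (M *m x) <= L * dotp x x.
Proof.
exists (1 + \sum_i \sum_j `|M i j|).
  by rewrite ltr_pwDl // sumr_ge0 // => i _; rewrite sumr_ge0.
move=> x; rewrite mulrDl mul1r.
apply: (@le_trans _ _ ((\sum_i \sum_j `|M i j|) * dotp x x)); last first.
  by rewrite lerDr dotp_ge0.
rewrite {1}dotpE mulr_suml ler_sum // => i _.
rewrite mxE mulr_sumr mulr_suml ler_sum // => j _.
have sq_le k : x k 0 ^+ 2 <= dotp x x.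
  rewrite dotpE (bigD1 k) //= -expr2 lerDl sumr_ge0 // => l _.
  by rewrite -expr2 sqr_ge0.
apply: (@le_trans _ _ (`|M i j| * (`|x i 0| * `|x j 0|))).
  by rewrite -!normrM [leRHS](_ : _ = `|x i 0 * (M i j * x j 0)|) ?ler_norm //
    mulrCA.
apply: ler_wpM2l => //; have := sq_le i; have := sq_le j.
rewrite -!(real_normK (num_real (x _ _))).
have := sqr_ge0 (`|x i 0| - `|x j 0|); nra.
Qed.

Lemma posdef_unitmx Q : posdef Q -> Q \in unitmx.
Proof.
case=> Qs Qp; rewrite -row_free_unit -kermx_eq0; apply/rowV0P => v /sub_kermxP vQ.
have [v0|v0] := eqVneq v^T 0; first by rewrite -[v]trmxK v0 trmx0.
have := Qp _ v0.
by rewrite -{1}Qs -trmx_mul vQ trmx0 /dotp mulmx0 mxE ltxx.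
Qed.

(** Positivity of the form at x - t y, where t is the minimizing coefficient. *)
Lemma posdef_cauchy_schwarz Q x y : posdef Q ->
  dotp x (Q *m y) ^+ 2 <= dotp x (Q *m x) * dotp y (Q *m y).
Proof.
move=> Qp; have [->|y0] := eqVneq y 0.
  by rewrite mulmx0 /dotp !mulmx0 mxE expr0n mulr0.
have yy := Qp.2 _ y0.
set t := dotp x (Q *m y) / dotp y (Q *m y).
have := posdef_ge0 (x - t *: y) Qp.
rewrite mulmxDr mulmxN -scalemxAr !dotp_bilin (dotp_symm y x Qp.1).
have tE : t * dotp y (Q *m y) = dotp x (Q *m y) by rewrite divfK // gt_eqF.
set p := dotp x (Q *m y) in t tE *; set q := dotp y (Q *m y) in yy t tE *.
rewrite -tE; move: (dotp x _) => a; nra.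
Qed.

(** A lower bound for Q follows from an upper bound for its inverse, without any
compactness: the Cauchy-Schwarz inequality for Q at x and Q^-1 x reads
|x|^4 <= (x . Q x) (x . Q^-1 x), and x . Q^-1 x <= L |x|^2. *)
Lemma posdef_coercive Q : posdef Q ->
  exists2 mu : R, 0 < mu & forall x, mu * dotp x x <= dotp x (Q *m x).
Proof.
move=> Qp; have Qu := posdef_unitmx _ Qp.
have [L L0 Lb] := quadratic_form_bound (invmx Q).
exists L^-1; rewrite ?invr_gt0 // => x.
have [->|x0] := eqVneq x 0; first by rewrite mulmx0 /dotp !mulmx0 mxE mulr0.
have xx : 0 < dotp x x.
  rewrite lt_neqAle dotp_ge0 andbT eq_sym; apply: contra_neq x0; exact: dotp_eq0.
have := posdef_cauchy_schwarz _ x (invmx Q *m x) Qp.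
rewrite mulKVmx // (dotpC (invmx Q *m x)).
have := Lb x; have xQx := posdef_ge0 x Qp => Lbx cs.
rewrite ler_pdivrMl // -(ler_pM2r xx) -expr2.
move: (dotp x (invmx Q *m x)) (dotp x (Q *m x)) Lbx cs xQx => p q Lbx cs xQx; nra.
Qed.

(** The exact second-order expansion. It yields the derivative as the limit of an
affine difference quotient, and strong convexity as an identity. *)
Lemma quadD Q c x v (h : R) : Q^T = Q ->
  quad Q c (x + h *: v) =
  quad Q c x + h * dotp v (Q *m x + c) + h ^+ 2 / 2 * dotp v (Q *m v).
Proof.
move=> Qs; rewrite /quad mulmxDr -scalemxAr !dotp_bilin.
by rewrite (dotp_symm x v Qs) (dotpC c v); field.
Qed.

Lemma quad_derive Q c x v : Q^T = Q ->
  'D_v (quad Q c) x = dotp v (Q *m x + c).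
Proof.
move=> Qs; rewrite /derive; apply: cvg_lim => //.
apply: (@cvg_trans _ (((fun h : R => dotp v (Q *m x + c)
    + h * (dotp v (Q *m v) / 2)) h) @[h --> 0^'])).
  apply: near_eq_cvg; near=> h => /=.
  have h0 : h != 0 by near: h; exact: nbhs_dnbhs_neq.
  by rewrite (addrC (h *: v)) quadD // /GRing.scale /=; field.
apply: cvg_trans; first by apply: cvg_app; exact: nbhs_dnbhs.
have {2}-> : dotp v (Q *m x + c) =
    dotp v (Q *m x + c) + 0 * (dotp v (Q *m v) / 2) by rewrite mul0r addr0.
by apply: cvgD; [exact: cvg_cst | apply: cvgMr_tmp; exact: cvg_id].
Unshelve. all: by end_near. Qed.

Lemma quad_gradient Q c : Q^T = Q -> gradient (quad Q c) = fun x => Q *m x + c.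
Proof.
move=> Qs; apply/funext => x; apply/colP => i.
rewrite mxE quad_derive // dotpE (bigD1 i) //= big1 ?addr0.
  by rewrite !mxE !eqxx mul1r.
by move=> j ji; rewrite [delta_mx _ _ _ _]mxE (negbTE ji) mul0r.
Qed.

Lemma quad_differentiable Q c x : differentiable (quad Q c) x.
Proof.
have dcoord i : differentiable (fun y : 'cV[R]_n => y i 0) x.
  exact: differentiable_coord.
have -> : quad Q c = \sum_i ((2^-1 : R) *:
    ((fun y => y i 0) * \sum_j (Q i j *: (fun y : 'cV[R]_n => y j 0)))
    + c i 0 *: (fun y : 'cV[R]_n => y i 0)).
  apply/funext => y; rewrite fct_sumE big_split /= /quad !dotpE mulr_sumr.
  congr (_ + _); apply: eq_bigr => i _.
  by rewrite mxE fct_sumE.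
apply: differentiable_sum => i; apply: differentiableD.
  apply: differentiableZ; apply: differentiableM => //.
  by apply: differentiable_sum => j; exact: differentiableZ.
exact: differentiableZ.
Qed.

(** Continuity into a space of matrices is checked entry by entry. *)
Lemma affine_continuous Q c : continuous (fun x => Q *m x + c).
Proof.
have coord i : continuous (fun x => (Q *m x + c) i 0).
  move=> x; apply: differentiable_continuous.
  rewrite (_ : (fun _ => _) = \sum_j (Q i j *: (fun y : 'cV[R]_n => y j 0))
      + cst (c i 0)); last first.
    by apply/funext => y; rewrite /= !mxE fct_sumE.
  apply: differentiableD => //; apply: differentiable_sum => j.
  by apply: differentiableZ; exact: differentiable_coord.
move=> x; apply/(@cvg_ballP _ _ _ (nbhs (x : 'cV[R]_n))) => e e0.
near=> y; split => // i j; rewrite ord1; move: i; near: y.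
by apply: filter_forall => i; move/(@cvg_ballP _ _ _ (nbhs (x : 'cV[R]_n))) : (coord i x); exact.
Unshelve. all: by end_near. Qed.

Lemma posdef_strongly_convex Q c : posdef Q -> strongly_convex (quad Q c).
Proof.
move=> Qp; have [mu mu0 muP] := posdef_coercive _ Qp.
exists mu => // x y t /andP[t0 t1].
have -> : t *: x + (1 - t) *: y = y + t *: (x - y).
  by rewrite scalerBl scale1r scalerBr addrCA.
(* Both x and the convex combination are of the form y + h (x - y). *)
have xE : x = y + 1 *: (x - y) by rewrite scale1r addrC subrK.
rewrite [in quad Q c x]xE !quadD ?Qp.1 // enorm_sqr.
have := muP (x - y); move: (dotp _ _) (dotp _ _) (dotp _ _) (quad _ _ _).
move=> p q r s pq.
have : 0 <= t * (1 - t) by rewrite mulr_ge0 // subr_ge0.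
nra.
Qed.

Lemma quad_lipschitz_gradient Q c : Q^T = Q -> lipschitz_gradient (quad Q c).
Proof.
move=> Qs; have [L L0 LP] := quadratic_form_bound (Q^T *m Q).
exists (Num.sqrt L); first exact: sqrtr_ge0.
move=> x y; rewrite quad_gradient // opprD addrACA subrr addr0 -mulmxBr.
rewrite /enorm -sqrtrM ?(ltW L0) //; apply: ler_wsqrtr.
by rewrite dotp_mulmx mulmxA LP.
Qed.

Lemma quad_continuously_differentiable Q c : Q^T = Q ->
  continuously_differentiable (quad Q c).
Proof.
move=> Qs; split; first by move=> x; exact: quad_differentiable.
by rewrite quad_gradient //; exact: affine_continuous.
Qed.

End PositiveDefiniteQuadratics.

Lemma slack_qp_classC {R : realType} {m nx ny : nat} (Q1 : 'M[R]_nx)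
    (c1 : 'cV[R]_nx) (Q2 : 'M[R]_ny) (c2 : 'cV[R]_ny) (A : 'M[R]_(m, nx))
    (B : 'M[R]_(m, ny)) (b : 'cV[R]_m) :
  (0 < m)%N -> (0 < nx)%N -> (0 < ny)%N -> posdef Q1 -> posdef Q2 ->
  row_free (row_mx A B) -> classC (slack_qp Q1 c1 Q2 c2 A B b).
Proof.
by move=> m0 nx0 ny0 Q1p Q2p AB; split=> //; split;
  [exact: (quad_continuously_differentiable _ _ Q1p.1)
  |exact: posdef_strongly_convex
  |exact: (quad_lipschitz_gradient _ _ Q1p.1)
  |exact: (quad_continuously_differentiable _ _ Q2p.1)
  |exact: posdef_strongly_convex
  |exact: (quad_lipschitz_gradient _ _ Q2p.1)].
Qed.

(** * Plane rotations *)

Lemma cvg_components {U V : topologicalType} (f : nat -> U) (g : nat -> V)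
    (u : U) (v : V) :
  (fun k => (f k, g k)) @ \oo --> (u, v) -> f @ \oo --> u /\ g @ \oo --> v.
Proof.
move=> fg; split.
  exact: (cvg_comp _ _ fg (@cvg_fst _ _ (nbhs u) (nbhs v) _)).
exact: (cvg_comp _ _ fg (@cvg_snd _ _ (nbhs u) (nbhs v) _)).
Qed.

Lemma iterates_cvg_xy {R : realType} {m nx ny : nat} (x : nat -> 'cV[R]_nx)
    (y : nat -> 'cV[R]_ny) (z lam : nat -> 'cV[R]_m) :
  iterates_cvg x y z lam -> exists (a : 'cV[R]_nx) (b : 'cV[R]_ny),
    (forall i, x k i 0 @[k --> \oo] --> a i 0) /\
    (forall i, y k i 0 @[k --> \oo] --> b i 0).
Proof.
case=> -[[[a b] c] d] /cvg_components[/cvg_components[/cvg_components[xa yb] _] _].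
exists a, b; split=> i.
  exact: (cvg_comp _ _ xa (@coord_continuous R nx 1 i 0 a)).
exact: (cvg_comp _ _ yb (@coord_continuous R ny 1 i 0 b)).
Qed.

Section PlaneRotation.
Context {R : realType}.

Definition rotate (c s : R) (p : R * R) : R * R :=
  (c * p.1 - s * p.2, s * p.1 + c * p.2).

Lemma rotate_norm c s p k : c ^+ 2 + s ^+ 2 = 1 ->
  (iter k (rotate c s) p).1 ^+ 2 + (iter k (rotate c s) p).2 ^+ 2 =
  p.1 ^+ 2 + p.2 ^+ 2.
Proof.
move=> cs1; elim: k => [//|k <-] /=; move: (iter _ _ _) => [a b] /=.
rewrite -[RHS]mul1r -cs1; ring.
Qed.

(** A limit of the orbit would be a fixed point of the rotation, hence the origin,
whereas the norm is constant along the orbit and nonzero. *)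
Lemma rotate_not_cvg c s p (a b : R) :
  c ^+ 2 + s ^+ 2 = 1 -> s != 0 -> p.1 ^+ 2 + p.2 ^+ 2 != 0 ->
  (iter k (rotate c s) p).1 @[k --> \oo] --> a ->
  (iter k (rotate c s) p).2 @[k --> \oo] --> b -> False.
Proof.
move=> cs1 s0 p0 ua ub; set u := fun k => iter k (rotate c s) p.
have ua' : (u k.+1).1 @[k --> \oo] --> c * a - s * b.
  by apply: cvgB; exact: cvgMl_tmp.
have ub' : (u k.+1).2 @[k --> \oo] --> s * a + c * b.
  by apply: cvgD; exact: cvgMl_tmp.
have ea : a = c * a - s * b.
  apply: (cvg_unique _ _ ua') => //.
  by move: ua; rewrite -(cvg_shiftS (fun k => (u k).1)).
have eb : b = s * a + c * b.
  apply: (cvg_unique _ _ ub') => //.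
  by move: ub; rewrite -(cvg_shiftS (fun k => (u k).2)).
have n0 : a ^+ 2 + b ^+ 2 = p.1 ^+ 2 + p.2 ^+ 2.
  have : (u k).1 ^+ 2 + (u k).2 ^+ 2 @[k --> \oo] --> a ^+ 2 + b ^+ 2.
    by apply: cvgD; apply: cvgM.
  rewrite (_ : (fun k => _) = cst (p.1 ^+ 2 + p.2 ^+ 2)); last first.
    by apply/funext => k; exact: rotate_norm.
  by move/(cvg_unique _ (cvg_cst _))=> ->.
have : s * (a ^+ 2 + b ^+ 2) =
    b * (a - (c * a - s * b)) - a * (b - (s * a + c * b)) by ring.
rewrite -ea -eb !subrr !mulr0 subrr.
by apply/eqP; rewrite mulf_neq0 ?n0.
Qed.

End PlaneRotation.

(** * Explicit vectors and matrices *)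

Section SmallVectors.
Context {R : realType}.

Definition vec2 (a b : R) : 'cV[R]_2 := \col_i [:: a; b]`_i.
Definition vec3 (a b c : R) : 'cV[R]_3 := \col_i [:: a; b; c]`_i.

Lemma vec3D a b c a' b' c' :
  vec3 a b c + vec3 a' b' c' = vec3 (a + a') (b + b') (c + c').
Proof. by apply/colP => -[[|[|[|]]]//= ?]; rewrite !mxE. Qed.

Lemma vec3N a b c : - vec3 a b c = vec3 (- a) (- b) (- c).
Proof. by apply/colP => -[[|[|[|]]]//= ?]; rewrite !mxE. Qed.

Lemma vec3Z k a b c : k *: vec3 a b c = vec3 (k * a) (k * b) (k * c).
Proof. by apply/colP => -[[|[|[|]]]//= ?]; rewrite !mxE. Qed.

Lemma vec2D a b a' b' : vec2 a b + vec2 a' b' = vec2 (a + a') (b + b').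
Proof. by apply/colP => -[[|[|]]//= ?]; rewrite !mxE. Qed.

Definition sym2 (a b d : R) : 'M[R]_2 :=
  \matrix_(i, j) (nth [::] [:: [:: a; b]; [:: b; d]] i)`_j.

Lemma mul_sym2 a b d x y :
  sym2 a b d *m vec2 x y = vec2 (a * x + b * y) (b * x + d * y).
Proof.
by apply/colP => -[[|[|]]//= ?];
  rewrite !mxE !big_ord_recl big_ord0 !mxE /= addr0.
Qed.

Lemma sym2_posdef a b d : 0 < a -> b ^+ 2 < a * d -> posdef (sym2 a b d).
Proof.
move=> a0 bad; split.
  by apply/matrixP => -[[|[|]]//= ?] [[|[|]]//= ?]; rewrite !mxE.
move=> x x0; have [u [v xE]] : exists u v, x = vec2 u v.
  exists (x 0 0), (x 1 0); apply/colP => -[[|[|]]//= ?]; rewrite !mxE /=;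
  by congr (x _ _); apply: val_inj.
rewrite xE in x0 *; rewrite mul_sym2 dotpE !big_ord_recl big_ord0 !mxE /= addr0.
have [v0|v0] := eqVneq v 0.
  have u0 : u != 0.
    apply: contra_neq x0 => u0; rewrite u0 v0.
    by apply/colP => -[[|[|]]//= ?]; rewrite !mxE.
  have : 0 < u ^+ 2 by rewrite exprn_even_gt0.
  rewrite v0; nra.
have : 0 < v ^+ 2 by rewrite exprn_even_gt0.
have := sqr_ge0 (a * u + b * v).
rewrite -(pmulr_rgt0 _ a0); nra.
Qed.

Lemma scalar1_posdef (a : R) : 0 < a -> posdef (a%:M : 'M[R]_1).
Proof.
move=> a0; split; first exact: tr_scalar_mx.
move=> x x0; rewrite mul_scalar_mx dotpZr mulr_gt0 // lt_neqAle dotp_ge0 andbT.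
by rewrite eq_sym; apply: contra_neq x0; exact: dotp_eq0.
Qed.

Lemma mx_norm_le m n (M : 'M[R]_(m, n)) (k : R) :
  0 <= k -> (forall i j, `|M i j| <= k) -> `|M| <= k.
Proof.
move=> k0 Mk; rewrite [leLHS]/Num.norm /= mx_normrE.
by apply/bigmax_leP; split => // -[i j] _; exact: Mk.
Qed.

Lemma vec3_norm_le (u v w k : R) :
  `|u| <= k -> `|v| <= k -> `|w| <= k -> `|vec3 u v w| <= k.
Proof.
move=> uk vk wk; apply: mx_norm_le; first exact: le_trans uk.
by move=> [[|[|[|]]]//= ?] j; rewrite mxE.
Qed.

Lemma vec2_norm_le (u v k : R) : `|u| <= k -> `|v| <= k -> `|vec2 u v| <= k.
Proof.
move=> uk vk; apply: mx_norm_le; first exact: le_trans uk.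
by move=> [[|[|]]//= ?] j; rewrite mxE.
Qed.

End SmallVectors.

(** * A program whose iterates rotate *)

Section RotatingOrbit.
Context {R : realType} (theta beta : R).
Context (theta_gt0 : 0 < theta) (theta_le1 : theta <= 1) (beta_gt0 : 0 < beta).

(** The tangent of half the rotation angle. A small multiple of [theta] keeps the
perturbations below small; the factor 128 gives theta / (2 T) = 64. *)
Definition tan_half : R := theta / 128.
Local Notation T := tan_half.
(** The sine and the cosine of the rotation angle, as rational functions of T. *)
Definition rot_s : R := 2 * T / (1 + T ^+ 2).
Local Notation s := rot_s.
Definition rot_c : R := 1 - T * s.
Local Notation c := rot_c.

(** The number h = h_re + i h_im is the second coordinate of u + v. Its imaginary
part is a free choice: with 64 (3 / 8) = 24, the leading parts 24 - 16 of
[gram11] and 32 - 24 of [curv_y] are both positive. The real part is then forced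
by the condition that v . p' be real, which reads
64 h_re / s = 2 (1 + 16 T) + (1 - 64 T) h_im / s. *)
Definition slip_re : R := s * ((19 + 64 * T) / 512).
Definition slip_im : R := s * (3 / 8).
Local Notation hr := slip_re.
Local Notation hi := slip_im.

(** The second coordinate of p, divided by s. *)
Definition force_re : R := -24 - (1 - 64 * T) * ((19 + 64 * T) / 512) + T.
Definition force_im : R := 3 + 32 * T.
Local Notation fr := force_re.
Local Notation fi := force_im.

(** The products Re u . Re p and Re u . Im p, divided by s. *)
Definition gram11 : R := - (16 + T) + (-1 + hr) * fr.
Definition gram12 : R := - (1 - 16 * T) + (-1 + hr) * fi.
(** The square of the third coordinate r of Im u, divided by s. The third
coordinate of Re p is - 64 r, so the equality of Im u . Re p and Re u . Im p is a
linear equation for r ^ 2. *)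
Definition tilt2 : R := (16 * (16 + T) + hi * fr - gram12) / 64.
(** The product Im u . Im p, divided by s. *)
Definition gram22 : R := 16 * (1 - 16 * T) + hi * fi - (1 - 64 * T) * tilt2.
(** The product v . p', divided by s. *)
Definition curv_y : R := 8 - 2 * T - (1 - 64 * T) * ((19 + 64 * T) / 512).
Definition tilt : R := Num.sqrt (s * tilt2).
Local Notation r := tilt.

Let T_gt0 : 0 < T. Proof. by move: theta_gt0 theta_le1; rewrite /T; lra. Qed.
Let T_le : T <= 1 / 128. Proof. by move: theta_gt0 theta_le1; rewrite /T; lra. Qed.

Lemma rot_s_bounds : 0 < s <= 2 * T.
Proof.
have T0 := T_gt0; have T2 : 1 <= 1 + T ^+ 2 by rewrite lerDl sqr_ge0.
have T2' : 0 < 1 + T ^+ 2 by lra.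
rewrite /s divr_gt0 ?mulr_gt0 //= ler_pdivrMr // ler_peMr //; lra.
Qed.

Let s_gt0 : 0 < s. Proof. by case/andP: rot_s_bounds. Qed.
Let s_le : s <= 1 / 64.
Proof. by case/andP: rot_s_bounds => _; have := T_le; lra. Qed.

Lemma rot_cs1 : c ^+ 2 + s ^+ 2 = 1.
Proof.
have T0 : 1 + T ^+ 2 != 0 by rewrite gt_eqF // ltr_pwDl // sqr_ge0.
by rewrite /c /s; field.
Qed.

Lemma slip_re_bounds : 0 < hr <= 1 / 1000.
Proof.
rewrite /hr; have := T_gt0; have := T_le; have := s_gt0; have := s_le; nra.
Qed.

Lemma slip_im_bounds : 0 < hi <= 1 / 100.
Proof. rewrite /hi; have := s_gt0; have := s_le; lra. Qed.

Lemma force_re_bounds : -25 <= fr <= - (47 / 2).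
Proof. rewrite /fr; have := T_gt0; have := T_le; nra. Qed.

Lemma force_im_bounds : 3 <= fi <= 13 / 4.
Proof. rewrite /fi; have := T_gt0; have := T_le; lra. Qed.

(** The Gram entries stay close to 8, -4 and 12, so crude bounds suffice. *)
Lemma gram11_ge : 7 <= gram11.
Proof.
have /andP[? ?] := slip_re_bounds; have /andP[? ?] := force_re_bounds.
have := T_le; rewrite /gram11; nra.
Qed.

Lemma gram12_bounds : -5 <= gram12 <= 0.
Proof.
have /andP[? ?] := slip_re_bounds; have /andP[? ?] := force_im_bounds.
have := T_gt0; have := T_le; rewrite /gram12; nra.
Qed.

Lemma tilt2_bounds : 3 <= tilt2 <= 5.
Proof.
have /andP[? ?] := slip_im_bounds; have /andP[? ?] := force_re_bounds.
have /andP[? ?] := gram12_bounds.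
have := T_gt0; have := T_le; rewrite /tilt2; nra.
Qed.

Lemma gram22_ge : 8 <= gram22.
Proof.
have /andP[? ?] := slip_im_bounds; have /andP[? ?] := force_im_bounds.
have /andP[? ?] := tilt2_bounds.
have := T_gt0; have := T_le; rewrite /gram22; nra.
Qed.

Lemma curv_y_gt0 : 0 < curv_y.
Proof. have := T_gt0; have := T_le; rewrite /curv_y; nra. Qed.

Lemma tilt_sqr : r ^+ 2 = s * tilt2.
Proof.
rewrite sqr_sqrtr // mulr_ge0 ?(ltW s_gt0) //.
by have /andP[+ _] := tilt2_bounds; apply: le_trans.
Qed.

Lemma tilt_bounds : 0 < r <= 1 / 2.
Proof.
have /andP[? ?] := tilt2_bounds; have := s_gt0; have := s_le => ? ?.
have st : 0 < s * tilt2 by apply: mulr_gt0 => //; lra.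
rewrite /r sqrtr_gt0 st /=.
have -> : (1 / 2 : R) = Num.sqrt ((1 / 2) ^+ 2) by rewrite sqrtr_sqr ger0_norm.
apply: ler_wsqrtr; nra.
Qed.

Definition orbit_Q1 : 'M[R]_2 :=
  sym2 (beta * s * gram11) (beta * s * gram12) (beta * s * gram22).
Definition orbit_Q2 : 'M[R]_1 := (beta * s * curv_y)%:M.
Definition orbit_A : 'M[R]_(3, 2) :=
  \matrix_(i, j) (nth [::] [:: [:: -1; 16]; [:: -1 + hr; hi]; [:: 0; r]] i)`_j.
Definition orbit_B : 'M[R]_(3, 1) := vec3 2 1 0.

Lemma orbit_Q1_posdef : posdef orbit_Q1.
Proof.
have bs : 0 < beta * s by rewrite mulr_gt0.
have ? := gram11_ge; have ? := gram22_ge; have /andP[? ?] := gram12_bounds.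
apply: sym2_posdef; first by rewrite mulr_gt0 //; lra.
rewrite exprMn [ltRHS]mulrACA -expr2 ltr_pM2l ?exprn_gt0 //; nra.
Qed.

Lemma orbit_Q2_posdef : posdef orbit_Q2.
Proof. by apply: scalar1_posdef; rewrite mulr_gt0 ?curv_y_gt0 // mulr_gt0. Qed.

Lemma mul_orbit_A x1 x2 : orbit_A *m vec2 x1 x2 =
  vec3 (- x1 + 16 * x2) ((-1 + hr) * x1 + hi * x2) (r * x2).
Proof.
by apply/colP => -[[|[|[|]]]//= ?]; rewrite !mxE !big_ord_recl big_ord0 !mxE /=;
  ring.
Qed.

Lemma mul_orbit_AT v1 v2 v3 : orbit_A^T *m vec3 v1 v2 v3 =
  vec2 (- v1 + (-1 + hr) * v2) (16 * v1 + hi * v2 + r * v3).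
Proof.
by apply/colP => -[[|[|]]//= ?]; rewrite !mxE !big_ord_recl big_ord0 !mxE /=;
  ring.
Qed.

Lemma mul_orbit_B (y : R) : orbit_B *m y%:M = vec3 (2 * y) y 0.
Proof. by rewrite mul_mx_scalar vec3Z mulr1 mulr0 mulrC. Qed.

Lemma mul_orbit_BT v1 v2 v3 : orbit_B^T *m vec3 v1 v2 v3 = (2 * v1 + v2)%:M.
Proof.
apply/colP => i; rewrite !ord1 !mxE !big_ord_recl big_ord0 !mxE /=; ring.
Qed.

(** For a row vector in the kernel, the first column of A and the column of B give
two equations in the first two entries, with determinant 1 - 2 h_re; the second
column of A then kills the third entry, because r is positive. *)
Lemma orbit_row_free : row_free (row_mx orbit_A orbit_B).
Proof.
rewrite -kermx_eq0; apply/rowV0P => v /sub_kermxP; rewrite mul_mx_row => vAB.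
have [vA vB] : v *m orbit_A = 0 /\ v *m orbit_B = 0.
  by move: vAB; rewrite -row_mx0 => /eq_row_mx.
have [v1 [v2 [v3 vE]]] : exists v1 v2 v3, v^T = vec3 v1 v2 v3.
  exists (v 0 0), (v 0 1), (v 0 2%:R).
  by apply/colP => -[[|[|[|]]]//= ?]; rewrite !mxE /=; congr (v _ _);
    apply: val_inj.
move: vA vB => /(congr1 trmx) + /(congr1 trmx).
rewrite !trmx_mul !trmx0 vE mul_orbit_AT mul_orbit_BT => vA vB.
have /= e1 := congr1 (fun M : 'cV[R]_2 => M 0 0) vA.
have /= e2 := congr1 (fun M : 'cV[R]_2 => M 1 0) vA.
have /= e3 := congr1 (fun M : 'M[R]_1 => M 0 0) vB.
move: e1 e2 e3; rewrite !mxE /= mulr1n => e1 e2 e3.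
have /andP[? ?] := slip_re_bounds; have /andP[r0 _] := tilt_bounds.
have v10 : v1 = 0.
  have /eqP : (1 - 2 * hr) * v1 = 0 by rewrite -e1; nra.
  by rewrite mulf_eq0 => /orP[/eqP|/eqP//]; lra.
have v20 : v2 = 0 by lra.
have v30 : v3 = 0.
  have /eqP : r * v3 = 0 by move: e2; rewrite v10 v20; lra.
  by rewrite mulf_eq0 gt_eqF //= => /eqP.
by rewrite -[v]trmxK vE v10 v20 v30; apply/rowP => -[[|[|[|]]]//= ?]; rewrite !mxE.
Qed.

(** The size of the positive slack and of the dual margins at the KKT point: it has
to exceed the amplitude of the orbit in these variables. *)
Definition offset : R := 600.
Local Notation K := offset.
Definition orbit_lam_eq : 'cV[R]_3 := beta *: vec3 0 (- K) (- K).
(** With these linear terms, x = 0 and y = 0 are stationary for the multiplier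
[orbit_lam_eq]. *)
Definition orbit_c1 : 'cV[R]_2 := orbit_A^T *m orbit_lam_eq.
Definition orbit_c2 : 'cV[R]_1 := orbit_B^T *m orbit_lam_eq.
Definition orbit_rhs : 'cV[R]_3 := vec3 K 0 0.
Definition orbit_qp : slack_problem R 3 2 1 :=
  slack_qp orbit_Q1 orbit_c1 orbit_Q2 orbit_c2 orbit_A orbit_B orbit_rhs.

(** The starting phase. The first x-step does not read x^0, but x^0 has to satisfy
the constraint, and this phase is the one at which the range of A contains the
vector b - B y^0 - z^0, so that a feasible x^0 exists. *)
Definition phase0 : R * R := (16 * (1 - hr), hr).
Definition phase (k : nat) : R * R := iter k (rotate c s) phase0.
Definition orbit_x (k : nat) : 'cV[R]_2 :=
  if k is 0%N then vec2 16 0 else vec2 (phase k).1 (- (phase k).2).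
Definition orbit_y (k : nat) : 'cV[R]_1 := (phase k).1%:M.
(** The first slack deviates from its equilibrium value by - Re ((u + v)_1 p), where
p is read as a complex number and (u + v)_1 = 1 + 16 i. *)
Definition slack_at (p : R * R) : 'cV[R]_3 := vec3 (K - p.1 + 16 * p.2) 0 0.
(** The last two coordinates deviate from the equilibrium multiplier by
beta Re ((- 64 T + 64 i) (u + v)_j p), which is theta zeta / (1 - zeta) (u + v)_j
with theta = 128 T; here (u + v)_2 = h and (u + v)_3 = i r. *)
Definition multiplier_at (p : R * R) : 'cV[R]_3 := beta *: vec3 0
  (- K - 64 * T * (hr * p.1 - hi * p.2) - 64 * (hi * p.1 + hr * p.2))
  (- K + 64 * T * (r * p.2) - 64 * (r * p.1)).
Definition orbit_z (k : nat) := slack_at (phase k).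
Definition orbit_lam (k : nat) := multiplier_at (phase k).

Lemma residual_orbit x1 x2 (y z : R) :
  residual orbit_qp (vec2 x1 x2) y%:M (vec3 z 0 0) =
  vec3 (- x1 + 16 * x2 + 2 * y + z - K) ((-1 + hr) * x1 + hi * x2 + y) (r * x2).
Proof.
rewrite /residual /= mul_orbit_A mul_orbit_B vec3N !vec3D.
by congr vec3; ring.
Qed.

(** The first coordinate is an identity between rational functions; the second one
is an identity modulo the equation that defines r ^ 2. *)
Lemma orbit_x_stationary p : let q := rotate c s p in
  orbit_Q1 *m vec2 q.1 (- q.2) + orbit_c1 =
  orbit_A^T *m (multiplier_at p
    - beta *: residual orbit_qp (vec2 q.1 (- q.2)) p.1%:M (slack_at p)).
Proof.
case: p => C S /=; rewrite residual_orbit /orbit_Q1 mul_sym2 /orbit_c1.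
rewrite /orbit_lam_eq /multiplier_at !vec3Z vec3N vec3D !mul_orbit_AT vec2D /=.
have T0 : 1 + T ^+ 2 != 0 by rewrite gt_eqF // ltr_pwDl // sqr_ge0.
congr vec2.
  rewrite /gram11 /gram12 /fr /fi /hr /hi /c /s; field; exact: T0.
(* The cofactor collects the terms in which the third row of A occurs twice. *)
apply/eqP; rewrite -subr_eq0; apply/eqP.
transitivity (beta * (64 * C - 64 * T * S - (s * C + c * S))
  * (r ^+ 2 - s * tilt2)).
  rewrite /gram22 /tilt2 /gram12 /fr /fi /hr /hi /c /s; field; exact: T0.
by rewrite tilt_sqr subrr mulr0.
Qed.

Lemma orbit_y_stationary p : let q := rotate c s p in
  orbit_Q2 *m q.1%:M + orbit_c2 =
  orbit_B^T *m (multiplier_at p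
    - beta *: residual orbit_qp (vec2 q.1 (- q.2)) q.1%:M (slack_at p)).
Proof.
case: p => C S /=; rewrite residual_orbit /orbit_Q2 /orbit_c2.
rewrite /orbit_lam_eq /multiplier_at !vec3Z vec3N vec3D !mul_orbit_BT /=.
rewrite -scalar_mxM -raddfD /=; congr (_%:M).
have T0 : 1 + T ^+ 2 != 0 by rewrite gt_eqF // ltr_pwDl // sqr_ge0.
rewrite /curv_y /hr /hi /c /s; field; exact: T0.
Qed.

Lemma residual_at q :
  residual orbit_qp (vec2 q.1 (- q.2)) q.1%:M (slack_at q) =
  vec3 0 (hr * q.1 - hi * q.2) (- (r * q.2)).
Proof. by rewrite residual_orbit; congr vec3; ring. Qed.

Lemma orbit_multiplier_update p : let q := rotate c s p in
  multiplier_at q = multiplier_at p -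
  (theta * beta) *: residual orbit_qp (vec2 q.1 (- q.2)) q.1%:M (slack_at q).
Proof.
move=> q; rewrite residual_at /q {q}; case: p => C S /=.
rewrite /multiplier_at !vec3Z vec3N vec3D /=.
have T0 : 1 + T ^+ 2 != 0 by rewrite gt_eqF // ltr_pwDl // sqr_ge0.
have -> : theta = 128 * T by rewrite /T; field.
congr vec3; first ring.
  rewrite /hr /hi /c /s; field; exact: T0.
rewrite /c /s; field; exact: T0.
Qed.

(** The orbit has squared norm close to 16 ^ 2. *)
Definition small (p : R * R) := `|p.1| <= 17 /\ `|p.2| <= 17.

Lemma phase_small k : small (phase k).
Proof.
have /andP[? ?] := slip_re_bounds.
have := rotate_norm _ _ phase0 k rot_cs1; rewrite -/(phase k) /= /small.
move: (phase k) => [C S] /= CS.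
have C2 := sqr_ge0 C; have S2 := sqr_ge0 S.
by split; rewrite -ler_sqr ?qualifE //= real_normK ?num_real //; nra.
Qed.

Lemma slack_at_orthant p : small p -> orthant (slack_at p).
Proof.
rewrite /small !ler_norml => -[]  /andP[? ?] /andP[? ?].
by move=> -[[|[|[|]]]//= ?]; rewrite mxE //= /K; lra.
Qed.

Lemma norm_mul_small (u v e : R) :
  0 < u <= e -> `|v| <= 17 -> `|u * v| <= 17 * e.
Proof.
by move=> /andP[u0 ue] v17; rewrite normrM (gtr0_norm u0) mulrC ler_pM // ltW.
Qed.

Lemma slip_small {p} : small p -> `|hr * p.1 - hi * p.2| <= 1.
Proof.
move=> [/(norm_mul_small _ _ _ slip_re_bounds) +
  /(norm_mul_small _ _ _ slip_im_bounds)].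
by rewrite !ler_norml; lra.
Qed.

Lemma conj_slip_small {p} : small p -> `|hi * p.1 + hr * p.2| <= 1.
Proof.
move=> [/(norm_mul_small _ _ _ slip_im_bounds) +
  /(norm_mul_small _ _ _ slip_re_bounds)].
by rewrite !ler_norml; lra.
Qed.

Lemma tilt_small {p} : small p -> `|r * p.1| <= 9 /\ `|r * p.2| <= 9.
Proof.
by move=> [/(norm_mul_small _ _ _ tilt_bounds) +
  /(norm_mul_small _ _ _ tilt_bounds)];
  split; lra.
Qed.

Lemma damped_small {v e : R} : `|v| <= e -> `|64 * T * v| <= e.
Proof.
have T0 := T_gt0; have T1 := T_le.
move=> ve; apply: le_trans ve; rewrite normrM ger0_norm; last by lra.
by rewrite ler_piMl //; lra.
Qed.

(** The vanishing slacks stay the right answer of the z-step: the gradient of its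
objective keeps the sign of [offset] in the last two coordinates. *)
Lemma orbit_dual_feasible {p q} : small p -> small q ->
  forall i, 0 <= beta * (vec3 0 (hr * q.1 - hi * q.2) (- (r * q.2))) i 0
    - multiplier_at p i 0.
Proof.
move=> ps qs [[|[|[|]]]//= ?]; rewrite !mxE /= -mulrBr;
  apply: (mulr_ge0 (ltW beta_gt0)); first by rewrite subr0.
  move: (slip_small qs) (damped_small (slip_small ps)) (conj_slip_small ps).
  by rewrite !ler_norml /K; lra.
have [r1 r2] := tilt_small ps; have [_ r2'] := tilt_small qs.
by move: r1 (damped_small r2) r2'; rewrite !ler_norml /K; lra.
Qed.



Lemma orbit_admm :
  admm orbit_qp beta (theta * beta) orbit_x orbit_y orbit_z orbit_lam.
Proof.
move=> k; set p := phase k; pose q := rotate c s p.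
have pS : phase k.+1 = q by [].
have ps : small p := phase_small k; have qs : small q := phase_small k.+1.
have dual := orbit_dual_feasible ps qs.
have [] := @admm_step_of_kkt R 3 2 1 orbit_Q1 orbit_c1 orbit_Q2 orbit_c2
  orbit_A orbit_B orbit_rhs beta (orbit_x k.+1) (orbit_y k) (orbit_y k.+1)
  (orbit_z k) (orbit_z k.+1) (orbit_lam k).
- exact: orbit_Q1_posdef.
- exact: orbit_Q2_posdef.
- exact: ltW.
- exact: slack_at_orthant.
- exact: slack_at_orthant.
- exact: (orbit_x_stationary p).
- exact: (orbit_y_stationary p).
- move=> i; have := dual i; rewrite -(residual_at q); exact.
- move=> i; rewrite /orbit_x /orbit_y /orbit_z pS (residual_at q).
  rewrite /orbit_lam -/p /slack_at /multiplier_at.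
  by case: i => [[|[|[|]]]//= ?]; rewrite !mxE /= ?mul0r // !mulr0 subr0 mulr0.
- by move=> xmin ymin zmin; split => //; exact: (orbit_multiplier_update p).
Qed.

Lemma orbit_feasible :
  orbit_A *m orbit_x 0 + orbit_B *m orbit_y 0 + orbit_z 0 = orbit_rhs.
Proof.
rewrite mul_orbit_A mul_orbit_B !vec3D /orbit_rhs /phase /phase0 /=.
by congr vec3; ring.
Qed.

Lemma slack_at_norm {p} : small p -> `|slack_at p| <= 2 * K.
Proof.
have K0 : 289 <= K by rewrite /K ler_nat.
move=> [p1 p2]; have K2 : 0 <= 2 * K by lra.
apply: vec3_norm_le; rewrite ?normr0 //.
by move: p1 p2; rewrite !ler_norml; lra.
Qed.

Lemma multiplier_at_norm {p} : small p -> `|multiplier_at p| <= beta * (2 * K).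
Proof.
move=> ps; rewrite normrZ gtr0_norm //; apply: (ler_wpM2l (ltW beta_gt0)).
have K0 : 594 <= K by rewrite /K ler_nat.
have K2 : 0 <= 2 * K by lra.
apply: vec3_norm_le; rewrite ?normr0 //.
  move: (damped_small (slip_small ps)) (conj_slip_small ps).
  by rewrite !ler_norml; lra.
have [r1 r2] := tilt_small ps.
by move: r1 (damped_small r2); rewrite !ler_norml; lra.
Qed.

Lemma orbit_bounded :
  bounded_fun (iterates orbit_x orbit_y orbit_z orbit_lam).
Proof.
have K17 : 17 <= K by rewrite /K ler_nat.
have K2 : K <= 2 * K by lra.
exists (2 * K + beta * (2 * K)); split; first exact: num_real.
move=> M /ltW ltM k _ /=; apply: le_trans ltM.
have ps := phase_small k.
have bK : 0 <= beta * (2 * K) by apply: mulr_ge0; [exact: ltW | lra].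
have le2K v : v <= 17 -> v <= 2 * K + beta * (2 * K).
  by move=> v17; apply: le_trans v17 _; lra.
rewrite /iterates !prod_normE /= !ge_max -!andbA; apply/and4P; split.
- apply: le2K; case: k ps => [_|k [p1 p2]].
    by apply: vec2_norm_le; rewrite ?normr0 // normr_nat ler_nat.
  by apply: vec2_norm_le; rewrite ?normrN.
- apply: le2K; apply: mx_norm_le => // i j; rewrite !ord1 mxE mulr1n.
  by case: ps.
- by apply: le_trans (slack_at_norm ps) _; rewrite lerDl.
- by apply: le_trans (multiplier_at_norm ps) _; rewrite lerDr; lra.
Qed.

(** The coordinates of the rotating point can be read off from x and y, except from
the initial x^0, which is not on the orbit; limits ignore it. *)
Lemma orbit_not_cvg :
  ~ iterates_cvg orbit_x orbit_y orbit_z orbit_lam.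
Proof.
move=> /iterates_cvg_xy[x [y [xk yk]]].
have cC : (phase k).1 @[k --> \oo] --> y 0 0.
  have := yk 0; rewrite (_ : (fun k => _) = fun k => (phase k).1) //.
  by apply/funext => k; rewrite /orbit_y mxE mulr1n.
have cS : (phase k).2 @[k --> \oo] --> - x 1 0.
  have /cvgN := xk 1; rewrite -cvg_shiftS -[X in _ -> X]cvg_shiftS.
  rewrite (_ : (fun k => _) = fun k => (phase k.+1).2) //.
  by apply/funext => k; rewrite -[LHS]/(- orbit_x k.+1 1 0) /orbit_x mxE opprK.
apply: rotate_not_cvg rot_cs1 _ _ cC cS.
  by rewrite gt_eqF.
rewrite gt_eqF // /phase0 /=.
have /andP[h0 _] := slip_re_bounds.
by rewrite ltr_wpDl ?sqr_ge0 // exprn_gt0.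
Qed.

End RotatingOrbit.

Theorem theorem3p2 (R : realType) (beta : R) (beta_gt0 : 0 < beta) :
  (forall theta : R, 0 < theta <= 80 / 119 ->
    exists (nx ny : nat) (Q1 : 'M[R]_nx) (c1 : 'cV[R]_nx)
      (Q2 : 'M[R]_ny) (c2 : 'cV[R]_ny)
      (A : 'M[R]_(3, nx)) (B : 'M[R]_(3, ny)) (b : 'cV[R]_3),
    [/\ (0 < nx)%N /\ (0 < ny)%N, posdef Q1, posdef Q2, row_free (row_mx A B) &
      exists (x : nat -> 'cV[R]_nx) (y : nat -> 'cV[R]_ny)
        (z lam : nat -> 'cV[R]_3),
      [/\ A *m x 0%N + B *m y 0%N + z 0%N = b /\ orthant (z 0%N),
          admm (slack_qp Q1 c1 Q2 c2 A B b) beta (theta * beta) x y z lam,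
          bounded_fun (iterates x y z lam)
        & ~ iterates_cvg x y z lam]]) /\
  ~ (exists2 theta_bar : R, 0 < theta_bar &
      forall (m nx ny : nat) (P : slack_problem R m nx ny), classC P ->
        forall theta : R, 0 < theta < theta_bar ->
          admm_converges P beta (theta * beta)).
Proof.
split=> [theta /andP[theta_gt0 theta_le]|[theta_bar bar_gt0 conv]].
  have theta_le1 : theta <= 1 by lra.
  exists 2, 1, (orbit_Q1 theta beta), (orbit_c1 theta beta),
    (orbit_Q2 theta beta), (orbit_c2 beta), (orbit_A theta), orbit_B, orbit_rhs.
  split=> //; [exact: orbit_Q1_posdef|exact: orbit_Q2_posdef
    |exact: orbit_row_free|].
  exists (orbit_x theta), (orbit_y theta), (orbit_z theta), (orbit_lam theta beta).
  split; [split|exact: orbit_admm|exact: orbit_bounded|exact: orbit_not_cvg].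
    exact: orbit_feasible.
  exact/slack_at_orthant/phase_small.
pose theta := Num.min (theta_bar / 2) 1.
have theta_gt0 : 0 < theta by rewrite lt_min; apply/andP; split; lra.
have theta_le1 : theta <= 1 by rewrite ge_min lexx orbT.
have theta_lt : 0 < theta < theta_bar.
  by rewrite theta_gt0 gt_min; apply/orP; left; lra.
apply: (orbit_not_cvg theta beta) => //.
apply: (conv _ _ _ (orbit_qp theta beta) _ theta) => //.
- by apply: slack_qp_classC => //; [exact: orbit_Q1_posdef
    |exact: orbit_Q2_posdef|exact: orbit_row_free].
- exact/slack_at_orthant/phase_small.
- exact: orbit_admm.
Qed.
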